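(* Let $M$ and $M'$ be two monotone roots, with involutions $J_0$ and $J_0'$. If $(C_*(M),J_0)$ and $(C_*(M'),J_0')$ are locally equivalent $\iota$-complexes, then $M=M'$.
   Context: $\mathbb F=\mathbb Z/2$; $\deg U=-2$. Monotone roots. Given rational numbers $h_1>\dots>h_n$ and $r_1<\dots<r_n$, all differing from one another by even integers, with $h_n\ge r_n$, the monotone root $M(h_1,r_1;\dots;h_n,r_n)$ is the infinite tree, with vertices graded by degree and each edge joining vertices whose degrees differ by $2$, consisting of an infinite stem (one vertex in each degree $r_n,r_n-2,r_n-4,\dots$) and, for each $i$ with $h_i>r_i$, a symmetric pair of leaves $v_i,J_0v_i$ in degree $h_i$ joined to the stem by a pair of disjoint paths meeting the stem only in the stem vertex of degree $r_i$; if $h_n=r_n$, then $v_n=J_0v_n$ is the top stem vertex. The involution $J_0$ fixes the stem and exchanges the paths in each pair. $M=M'$ means that they are the same monotone root, i.e. have the same parameters $(h_i,r_i)$. Standard complex. Let $v_1,\dots,v_N$ be the leaves of $M$ in left-to-right order in the symmetric planar drawing in which the $h_i$ decrease toward the stem; i.e. $v_1,\dots,v_n,J_0v_n,\dots,J_0v_1$, with the invariant leaf $v_n$ listed once if $h_n=r_n$. Write $\mathrm{gr}(v)$ for the degree of $v$. For $1\le i\le N-1$ let $\mathrm{gr}(\alpha_i)$ be the degree of the highest vertex at which the degree-decreasing infinite paths from $v_i$ and $v_{i+1}$ meet. $C_*(M)$ is the free $\mathbb F[U]$-complex with generators $v_i$ in degree $\mathrm{gr}(v_i)$ and $\alpha_i$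 in degree $\mathrm{gr}(\alpha_i)+1$, with $\partial v_i=0$, $\partial\alpha_i=U^{(\mathrm{gr}(v_i)-\mathrm{gr}(\alpha_i))/2}v_i+U^{(\mathrm{gr}(v_{i+1})-\mathrm{gr}(\alpha_i))/2}v_{i+1}$, and $J_0$ acts $\mathbb F[U]$-linearly by $v_i\mapsto v_{N-i+1}$, $\alpha_i\mapsto\alpha_{N-i}$. When the number of leaves is odd, the convention is to modify this complex by replacing the generator of the invariant middle leaf $v$ by two copies in degree $\mathrm{gr}(v)$ (left and right, swapped by $J_0$), together with an extra $J_0$-fixed odd generator in degree $\mathrm{gr}(v)+1$ whose boundary is the sum of the two copies. Local equivalence. An $\iota$-complex $(C,\iota)$ consists of a $\mathbb Q$-graded, finitely generated, free chain complex $C$ over $\mathbb F[U]$, supported in degrees differing from some $\tau\in\mathbb Q$ by integers, with $U^{-1}H_*(C)\cong\mathbb F[U,U^{-1}]$ relatively graded and supported in degrees differing from $\tau$ by even integers, together with a grading-preserving chain map $\iota$ with $\iota^2\simeq\mathrm{id}$. $(C,\iota)$ and $(C',\iota')$ are locally equivalent if there are grading-preserving ($\mathbb F[U]$-equivariant) chain maps $F:C\to C'$, $G:C'\to C$ with $F\circ\iota\simeq\iota'\circ F$, $G\circ\iota'\simeq\iota\circ G$ ($\mathbb F[U]$-equivariant chain homotopy), and such that $F$ and $G$ induce isomorphisms on homology after inverting $U$. *)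

(* Defs.v *)
From HB Require Import structures.
From mathcomp Require Import all_boot all_order all_algebra.
From mathcomp Require Import boolp zify lra.

Set Implicit Arguments.
Unset Strict Implicit.
Unset Printing Implicit Defensive.

Import Order.TTheory GRing.Theory Num.Theory.

Local Open Scope ring_scope.
Local Open Scope quotient_scope.

Notation FU := {poly 'F_2}.
Notation U := ('X : FU).

(* As [{poly 'F_2}] is natively an ['F_2]-module, [FU^o] is [FU] seen as a
   module over itself. *)
Notation freemod I := {ffun I -> FU^o}.

(* p and q differ by an even integer *)
Definition even_diff (p q : rat) : bool := (p - q) / 2 \is a Num.int.

(* x has degree q, where the generator i has degree gr i and U has degree -2;
   0 has every degree. *)
Definition homog (I : finType) (gr : I -> rat) (q : rat) (x : freemod I) : Prop :=
  forall i k, (x i : FU)`_k != 0 -> gr i - k.*2%:R = q.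

Definition map_degree (I J : finType) (gI : I -> rat) (gJ : J -> rat) (d : rat)
    (f : freemod I -> freemod J) : Prop :=
  forall q x, homog gI q x -> homog gJ (q + d) (f x).

(* The grading of F[U], 1 having degree 0 *)
Definition homogFU (q : rat) (p : FU^o) : Prop :=
  forall k, (p : FU)`_k != 0 -> - k.*2%:R = q.

(* Graded, finitely generated free complexes over F[U], presented by a finite
   homogeneous basis *)
Record complex := Complex {
  gens : finType;
  gdeg : gens -> rat;
  bd : {linear freemod gens -> freemod gens};
  bd_degree : map_degree gdeg gdeg (-1) bd;
  bd_bd : forall x, bd (bd x) = 0
}.

Definition cx_homog (C : complex) := homog (@gdeg C).

Record chain_map (C D : complex) := ChainMap {
  cmap :> {linear freemod (gens C) -> freemod (gens D)};
  cmap_degree : map_degree (@gdeg C) (@gdeg D) 0 cmap;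
  cmap_bd : forall x, cmap (bd C x) = bd D (cmap x)
}.

Definition homotopic (C D : complex) (f g : freemod (gens C) -> freemod (gens D)) : Prop :=
  exists h : {linear freemod (gens C) -> freemod (gens D)},
    map_degree (@gdeg C) (@gdeg D) 1 h /\
    forall x, f x - g x = bd D (h x) + h (bd C x).

Section Homology.
Variable C : complex.

Definition is_cycle : {pred freemod (gens C)} := [pred x | bd C x == 0].

Lemma is_cycle_submod : submod_closed is_cycle.
Proof.
split=> [|a x y]; rewrite !inE ?linear0 // => /eqP xZ /eqP yZ.
by rewrite linearP xZ yZ scaler0 addr0.
Qed.
HB.instance Definition _ := GRing.isSubmodClosed.Build _ _ is_cycle is_cycle_submod.

Record cycle := Cycle { cycle_val : freemod (gens C); _ : cycle_val \in is_cycle }.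
HB.instance Definition _ := [isSub for cycle_val].
HB.instance Definition _ := [Choice of cycle by <:].
HB.instance Definition _ := [SubChoice_isSubLmodule of cycle by <:].

Definition is_boundary : {pred cycle} := [pred z | `[< exists y, val z = bd C y >]].

Lemma is_boundary_zmod : zmod_closed is_boundary.
Proof.
split=> [|a b]; rewrite !inE; first by apply/asboolP; exists 0; rewrite linear0.
move=> /asboolP[x ax] /asboolP[y by_]; apply/asboolP; exists (x - y).
by rewrite !linearB /= ax by_.
Qed.
HB.instance Definition _ := GRing.isZmodClosed.Build _ is_boundary is_boundary_zmod.

Lemma is_boundaryZ a z : z \in is_boundary -> a *: z \in is_boundary.
Proof.
rewrite !inE => /asboolP[x ax]; apply/asboolP; exists (a *: x).
by rewrite !linearZ /= ax.
Qed.

Definition homology := Quotient.quot is_boundary.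
HB.instance Definition _ := GRing.Zmodule.on homology.
HB.instance Definition _ := EqQuotient.on homology.

Lemma homology_eqE (x y : cycle) :
  (\pi_homology x == \pi_homology y) = (x - y \in is_boundary).
Proof. by rewrite (Quotient.idealrBE is_boundary). Qed.

Definition homology_scale (a : FU) (x : homology) : homology :=
  \pi_homology (a *: repr x).

Lemma pi_homologyD x y :
  \pi_homology (x + y) = \pi_homology x + \pi_homology y.
Proof. exact: (Quotient.pi_add is_boundary x y). Qed.

Lemma pi_homology_scale a x :
  homology_scale a (\pi_homology x) = \pi_homology (a *: x).
Proof.
apply/eqP; rewrite homology_eqE -scalerBr is_boundaryZ //.
by rewrite -homology_eqE reprK.
Qed.

Lemma homology_scaleA a b x :
  homology_scale a (homology_scale b x) = homology_scale (a * b) x.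
Proof. by elim/quotW: x => x; rewrite (pi_homology_scale b x) !pi_homology_scale scalerA. Qed.

Lemma homology_scale1 : left_id 1 homology_scale.
Proof. by elim/quotW=> x; rewrite pi_homology_scale scale1r. Qed.

Lemma homology_scaleDr : right_distributive homology_scale +%R.
Proof.
move=> a; elim/quotW=> x; elim/quotW=> y; rewrite -pi_homologyD !pi_homology_scale.
by rewrite scalerDr pi_homologyD.
Qed.

Lemma homology_scaleDl x :
  {morph homology_scale^~ x : a b / a + b}.
Proof.
move=> a b; elim/quotW: x => x; rewrite !pi_homology_scale.
by rewrite scalerDl pi_homologyD.
Qed.

HB.instance Definition _ := GRing.Zmodule_isLmodule.Build FU homology
  homology_scaleA homology_scale1 homology_scaleDr homology_scaleDl.

Lemma pi_homology_linear : linear (\pi_homology : cycle -> homology).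
Proof. by move=> a x y; rewrite pi_homologyD -pi_homology_scale. Qed.

Definition homology_homog (q : rat) (c : homology) : Prop :=
  exists z : cycle, cx_homog q (val z) /\ c = \pi_homology z.

End Homology.

Arguments is_cycle : clear implicits.

Section HomologyMap.
Variables (C D : complex) (f : chain_map C D).

Lemma cmap_cycle (z : cycle C) : f (val z) \in is_cycle D.
Proof. by case: z => z /[dup] /eqP zZ zP; rewrite inE /= -cmap_bd zZ linear0. Qed.

Definition cycle_map (z : cycle C) : cycle D := Cycle (cmap_cycle z).

Definition homology_map (c : homology C) : homology D :=
  \pi_(homology D) (cycle_map (repr c)).

Lemma homology_mapE z :
  homology_map (\pi_(homology C) z) = \pi_(homology D) (cycle_map z).
Proof.
apply/eqP; rewrite homology_eqE inE; apply/asboolP.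
have /eqP := reprK (\pi_(homology C) z).
rewrite homology_eqE inE => /asboolP[y zy]; exists (f y).
by rewrite -cmap_bd -zy !linearB.
Qed.

Lemma homology_map_linear : linear homology_map.
Proof.
move=> a; elim/quotW=> x; elim/quotW=> y; rewrite -pi_homology_linear !homology_mapE.
rewrite -pi_homology_linear; congr (\pi_(homology D) _); apply: val_inj.
by rewrite /= !linearP.
Qed.

HB.instance Definition _ := GRing.isLinear.Build FU (homology C) (homology D) _
  homology_map homology_map_linear.

End HomologyMap.

(* [Uloc M] is the localization U^{-1}M of an F[U]-module M; the class of
   [(x, k)] is x/U^k. *)
Section Localization.
Variable M : lmodType FU.

Definition Uloc_eq : rel (M * nat) := fun x y =>
  `[< exists m, U ^+ (m + y.2) *: x.1 = U ^+ (m + x.2) *: y.1 >].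

Lemma Uloc_eq_refl : reflexive Uloc_eq.
Proof. by move=> x; apply/asboolP; exists 0%N. Qed.

Lemma Uloc_eq_sym : symmetric Uloc_eq.
Proof. by move=> x y; apply/asboolP/asboolP => -[m e]; exists m. Qed.

Lemma Uloc_eq_trans : transitive Uloc_eq.
Proof.
move=> [y b] [x a] [z c] /asboolP[m /= e1] /asboolP[n /= e2].
apply/asboolP; exists (m + n + b)%N => /=.
have -> : (m + n + b + c = (n + c) + (m + b))%N by lia.
have -> : (m + n + b + a = (m + a) + (n + b))%N by lia.
by rewrite exprD -scalerA e1 scalerA mulrC -scalerA e2 scalerA -exprD.
Qed.

Canonical Uloc_equiv := EquivRel Uloc_eq Uloc_eq_refl Uloc_eq_sym Uloc_eq_trans.

Definition Uloc := {eq_quot Uloc_eq}.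
HB.instance Definition _ := EqQuotient.on Uloc.
HB.instance Definition _ := Choice.on Uloc.

Definition Ufrac (x : M) (k : nat) : Uloc := \pi_Uloc (x, k).

Lemma UfracP x k y l :
  Ufrac x k = Ufrac y l <-> exists m, U ^+ (m + l) *: x = U ^+ (m + k) *: y.
Proof.
split=> [/eqP|e]; first by rewrite /Ufrac piE => /asboolP.
by apply/eqP; rewrite /Ufrac piE; apply/asboolP.
Qed.

Lemma Ufrac_ind (P : Uloc -> Prop) : (forall x k, P (Ufrac x k)) -> forall c, P c.
Proof. by move=> Pf c; rewrite -[c]reprK; case: (repr c) => x k; apply: Pf. Qed.

Lemma Ufrac_reprK c : Ufrac (repr c).1 (repr c).2 = c.
Proof. by rewrite /Ufrac -surjective_pairing reprK. Qed.

Lemma Ufrac_shift j x k : Ufrac (U ^+ j *: x) (j + k) = Ufrac x k.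
Proof. by apply/UfracP; exists 0%N; rewrite !add0n scalerA -exprD addnC. Qed.

Definition Uloc_add (c d : Uloc) : Uloc :=
  Ufrac (U ^+ (repr d).2 *: (repr c).1 + U ^+ (repr c).2 *: (repr d).1)
        ((repr c).2 + (repr d).2).
Definition Uloc_opp (c : Uloc) : Uloc := Ufrac (- (repr c).1) (repr c).2.
Definition Uloc_scale (a : FU) (c : Uloc) : Uloc := Ufrac (a *: (repr c).1) (repr c).2.

Lemma Uloc_addE x k y l :
  Uloc_add (Ufrac x k) (Ufrac y l) = Ufrac (U ^+ l *: x + U ^+ k *: y) (k + l).
Proof.
rewrite /Uloc_add.
move: (Ufrac_reprK (Ufrac x k)) (Ufrac_reprK (Ufrac y l)).
case: (repr _) => x' k' /=; case: (repr _) => y' l' /=.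
move=> /UfracP[m e1] /UfracP[n e2]; apply/UfracP; exists (m + n)%N.
rewrite !scalerDr !scalerA -!exprD; congr (_ + _).
- have -> : (m + n + (k + l) + l' = (n + l + l') + (m + k))%N by lia.
  have -> : (m + n + (k' + l') + l = (n + l + l') + (m + k'))%N by lia.
  by rewrite exprD -scalerA e1 scalerA -exprD.
- have -> : (m + n + (k + l) + k' = (m + k + k') + (n + l))%N by lia.
  have -> : (m + n + (k' + l') + k = (m + k + k') + (n + l'))%N by lia.
  by rewrite exprD -scalerA e2 scalerA -exprD.
Qed.

Lemma Uloc_oppE x k : Uloc_opp (Ufrac x k) = Ufrac (- x) k.
Proof.
rewrite /Uloc_opp; move: (Ufrac_reprK (Ufrac x k)).
case: (repr _) => x' k' /= /UfracP[m e]; apply/UfracP; exists m.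
by rewrite !scalerN e.
Qed.

Lemma Uloc_scaleE a x k : Uloc_scale a (Ufrac x k) = Ufrac (a *: x) k.
Proof.
rewrite /Uloc_scale; move: (Ufrac_reprK (Ufrac x k)).
case: (repr _) => x' k' /= /UfracP[m e]; apply/UfracP; exists m.
by rewrite !scalerA ![_ * a]mulrC -!scalerA e.
Qed.

Lemma Ufrac_same k x y : Uloc_add (Ufrac x k) (Ufrac y k) = Ufrac (x + y) k.
Proof. by rewrite Uloc_addE -scalerDr Ufrac_shift. Qed.

Lemma Uloc_addA : associative Uloc_add.
Proof.
elim/Ufrac_ind=> x k; elim/Ufrac_ind=> y l; elim/Ufrac_ind=> z m.
rewrite !Uloc_addE addnA; congr Ufrac.
by rewrite !scalerDr !scalerA -!exprD addrA ![(m + _)%N]addnC ?[(l + k)%N]addnC.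
Qed.

Lemma Uloc_addC : commutative Uloc_add.
Proof.
by elim/Ufrac_ind=> x k; elim/Ufrac_ind=> y l; rewrite !Uloc_addE addrC addnC.
Qed.

Lemma Uloc_add0 : left_id (Ufrac 0 0) Uloc_add.
Proof. by elim/Ufrac_ind=> x k; rewrite Uloc_addE scaler0 add0r scale1r. Qed.

Lemma Uloc_addN : left_inverse (Ufrac 0 0) Uloc_opp Uloc_add.
Proof.
elim/Ufrac_ind=> x k; rewrite Uloc_oppE Ufrac_same addNr.
by apply/UfracP; exists 0%N; rewrite !scaler0.
Qed.

HB.instance Definition _ := GRing.isZmodule.Build Uloc
  Uloc_addA Uloc_addC Uloc_add0 Uloc_addN.

Lemma Uloc_scaleA a b c : Uloc_scale a (Uloc_scale b c) = Uloc_scale (a * b) c.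
Proof. by elim/Ufrac_ind: c => x k; rewrite !Uloc_scaleE scalerA. Qed.

Lemma Uloc_scale1 : left_id 1 Uloc_scale.
Proof. by elim/Ufrac_ind=> x k; rewrite Uloc_scaleE scale1r. Qed.

Lemma Uloc_scaleDr : right_distributive Uloc_scale +%R.
Proof.
move=> a; elim/Ufrac_ind=> x k; elim/Ufrac_ind=> y l.
rewrite [_ + _]Uloc_addE !Uloc_scaleE [in RHS]/+%R /= Uloc_addE.
by rewrite scalerDr !scalerA ![a * _]mulrC.
Qed.

Lemma Uloc_scaleDl c : {morph Uloc_scale^~ c : a b / a + b}.
Proof.
move=> a b; elim/Ufrac_ind: c => x k.
by rewrite !Uloc_scaleE [in RHS]/+%R /= Ufrac_same scalerDl.
Qed.

HB.instance Definition _ := GRing.Zmodule_isLmodule.Build FU Uloc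
  Uloc_scaleA Uloc_scale1 Uloc_scaleDr Uloc_scaleDl.

Lemma UfracD x k y l :
  Ufrac x k + Ufrac y l = Ufrac (U ^+ l *: x + U ^+ k *: y) (k + l).
Proof. exact: Uloc_addE. Qed.

Lemma UfracZ a x k : a *: Ufrac x k = Ufrac (a *: x) k.
Proof. exact: Uloc_scaleE. Qed.

(* The grading of U^{-1}M induced by a grading P of M: [P q x] means that x is
   homogeneous of degree q. *)
Definition Uloc_homog (P : rat -> M -> Prop) (q : rat) (c : Uloc) : Prop :=
  exists x k, P (q - k.*2%:R) x /\ c = Ufrac x k.

End Localization.

Section LocalizationMap.
Variables (M N : lmodType FU) (f : {linear M -> N}).

Definition Uloc_map (c : Uloc M) : Uloc N := Ufrac (f (repr c).1) (repr c).2.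

Lemma Uloc_mapE x k : Uloc_map (Ufrac x k) = Ufrac (f x) k.
Proof.
rewrite /Uloc_map; move: (Ufrac_reprK (Ufrac x k)).
case: (repr _) => x' k' /= /UfracP[m e]; apply/UfracP; exists m.
by rewrite -!linearZ e.
Qed.

Lemma Uloc_map_linear : linear Uloc_map.
Proof.
move=> a; elim/Ufrac_ind=> x k; elim/Ufrac_ind=> y l.
rewrite UfracZ UfracD Uloc_mapE (Uloc_mapE x k) (Uloc_mapE y l) UfracZ UfracD.
have fZ b z : f (b *: z) = b *: f z by rewrite linearZ.
by rewrite linearD !fZ.
Qed.

HB.instance Definition _ := GRing.isLinear.Build FU (Uloc M) (Uloc N) _
  Uloc_map Uloc_map_linear.

End LocalizationMap.

(* Monotone roots, as lists of parameters [:: (h_1, r_1), ..., (h_n, r_n)];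
   indices start at 0 below. *)
Definition is_monotone (p : seq (rat * rat)) : bool :=
  [&& p != [::],
      sorted >%R (unzip1 p),
      sorted <%R (unzip2 p),
      all2rel even_diff (unzip1 p ++ unzip2 p) &
      (last (0, 0) p).2 <= (last (0, 0) p).1].

Record monotone_root := MonotoneRoot {
  mr_params :> seq (rat * rat);
  mr_monotone : is_monotone mr_params
}.
HB.instance Definition _ := [isSub for mr_params].

Section EvenDiff.

Lemma even_diffxx q : even_diff q q.
Proof. by rewrite /even_diff subrr mul0r rpred0. Qed.

Lemma even_diff_sym p q : even_diff p q = even_diff q p.
Proof. rewrite /even_diff; have -> : (p - q) / 2 = - ((q - p) / 2) by lra.
by rewrite rpredN. Qed.

Lemma even_diff_trans q p s : even_diff p q -> even_diff q s -> even_diff p s.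
Proof.
rewrite /even_diff => pq qs.
have -> : (p - s) / 2 = (p - q) / 2 + (q - s) / 2 by lra.
exact: rpredD.
Qed.

Lemma even_diffP p q : q <= p -> even_diff p q -> exists k, p = q + k.*2%:R.
Proof.
move=> le_qp /intrP[[k|k] e].
  exists k; rewrite -mul2n natrM; move: e; rewrite -pmulrn; lra.
have : (p - q) / 2 < 0 by rewrite e ltrz0.
lra.
Qed.

Lemma even_diffE p k : even_diff (p + k.*2%:R) p.
Proof.
rewrite /even_diff -mul2n natrM addrAC subrr add0r mulrC mulKf //.

Qed.

Lemma even_diff2 p : even_diff p (p - 2).
Proof. by have := even_diffE (p - 2) 1; rewrite subrK. Qed.

End EvenDiff.

Section MonotoneRootTheory.
Variable M : monotone_root.

Definition legs : nat := size M.
Definition mr_h (i : nat) : rat := (nth (0, 0) M i).1.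
Definition mr_r (i : nat) : rat := (nth (0, 0) M i).2.

Lemma legs_gt0 : (0 < legs)%N.
Proof. by rewrite /legs; case: M => -[]. Qed.

Lemma legs_pred_lt : (legs.-1 < legs)%N.
Proof. by case: legs legs_gt0. Qed.

Lemma mr_r_lt i j : (i < j < legs)%N -> mr_r i < mr_r j.
Proof.
move=> /andP[ij jl]; case/and5P: (mr_monotone M) => _ _ sr _ _.
have := sorted_ltn_nth lt_trans 0 sr; move=> /(_ i j).
rewrite !inE size_map => /(_ (ltn_trans ij jl) jl ij).
by rewrite !(nth_map (0, 0)) ?(ltn_trans ij jl).
Qed.

Lemma mr_h_gt i j : (i < j < legs)%N -> mr_h j < mr_h i.
Proof.
move=> /andP[ij jl]; case/and5P: (mr_monotone M) => _ sh _ _ _.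
have tr : transitive (>%R : rel rat) by move=> y x z /= xy /lt_trans; apply.
have := sorted_ltn_nth tr 0 sh; move=> /(_ i j).
rewrite !inE size_map => /(_ (ltn_trans ij jl) jl ij).
by rewrite !(nth_map (0, 0)) ?(ltn_trans ij jl).
Qed.

Lemma mr_last : mr_r legs.-1 <= mr_h legs.-1.
Proof. by case/and5P: (mr_monotone M) => _ _ _ _; rewrite -nth_last. Qed.

Lemma mr_r_le i : (i < legs)%N -> mr_r i <= mr_r legs.-1.
Proof.
move=> il; case: (ltnP i legs.-1) => [ll|ge]; last first.
  by have -> : i = legs.-1 by lia.
by apply: ltW; apply: mr_r_lt; rewrite ll legs_pred_lt.
Qed.

Lemma mr_h_ge i : (i < legs)%N -> mr_h legs.-1 <= mr_h i.
Proof.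
move=> il; case: (ltnP i legs.-1) => [ll|ge]; last first.
  by have -> : i = legs.-1 by lia.
by apply: ltW; apply: mr_h_gt; rewrite ll legs_pred_lt.
Qed.

Lemma mr_le i : (i < legs)%N -> mr_r i <= mr_h i.
Proof.
by move=> il; rewrite (le_trans (mr_r_le il)) ?(le_trans mr_last) ?mr_h_ge.
Qed.

Lemma mr_lt i : (i < legs.-1)%N -> mr_r i < mr_h i.
Proof.
move=> il; have il' : (i < legs)%N by lia.
by rewrite (lt_le_trans _ (mr_h_ge il')) // (lt_le_trans _ mr_last) // mr_r_lt // il legs_pred_lt.
Qed.

Lemma mr_even (a b : rat) :
  a \in unzip1 M ++ unzip2 M -> b \in unzip1 M ++ unzip2 M -> even_diff a b.
Proof. by case/and5P: (mr_monotone M) => _ _ _ /allrelP H _; apply: H. Qed.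

Lemma mr_h_in i : (i < legs)%N -> mr_h i \in unzip1 M ++ unzip2 M.
Proof. by move=> il; rewrite mem_cat (map_f fst) // mem_nth. Qed.

Lemma mr_r_in i : (i < legs)%N -> mr_r i \in unzip1 M ++ unzip2 M.
Proof. by move=> il; rewrite mem_cat orbC (map_f snd) // mem_nth. Qed.

(* The vertices of the tree: [(None, q)] is the stem vertex of degree q, and
   [(Some (i, b), q)] is the vertex of degree q on the path joining the stem to
   the leaf v_i (b = false) or J_0 v_i (b = true), the endpoint of degree r_i on
   the stem being excluded. *)
Definition is_vertex (x : option (nat * bool) * rat) : bool :=
  match x with
  | (None, q) => (q <= mr_r legs.-1) && even_diff (mr_r legs.-1) q
  | (Some (i, _), q) => [&& (i < legs)%N, mr_r i < q, q <= mr_h i & even_diff (mr_h i) q]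
  end.

Record vertex := Vertex { vlabel : option (nat * bool) * rat; _ : is_vertex vlabel }.
HB.instance Definition _ := [isSub for vlabel].
HB.instance Definition _ := [Choice of vertex by <:].

Definition vgr (v : vertex) : rat := (vlabel v).2.

(* Each vertex v is joined by an edge to exactly one vertex of lower degree,
   [down v]; there are no other edges, and the degree-decreasing infinite path
   from v is k |-> iter k down v. *)
Definition down_label (x : option (nat * bool) * rat) : option (nat * bool) * rat :=
  match x with
  | (None, q) => (None, q - 2)
  | (Some (i, b), q) => if q - 2 == mr_r i then (None, q - 2) else (Some (i, b), q - 2)
  end.

Lemma down_subproof (v : vertex) : is_vertex (down_label (vlabel v)).
Proof.
case: v => -[[[i b]|] q] /=; last first.
  move=> /andP[qr eq_]; rewrite (even_diff_trans eq_ (even_diff2 _)) andbT; lra.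
move=> /and4P[il rq qh eq_].
have ehr : even_diff (mr_h i) (mr_r i) by rewrite mr_even ?mr_h_in ?mr_r_in.
have erq : even_diff q (mr_r i) by rewrite even_diff_sym in eq_; apply: even_diff_trans eq_ ehr.
have [k qE] := even_diffP (ltW rq) erq.
have k0 : (0 < k)%N by case: k qE rq => // ->; rewrite addr0 ltxx.
have k2 : 2 <= k.*2%:R :> rat by rewrite (ler_nat _ 2); lia.
case: eqP => [e|/eqP ne] /=.
  by rewrite e mr_r_le //= mr_even ?mr_r_in // legs_pred_lt.
rewrite il (even_diff_trans eq_ (even_diff2 _)) andbT /= lt_neqAle eq_sym ne /=.
by apply/andP; split; lra.
Qed.

Definition down (v : vertex) : vertex := Vertex (down_subproof v).

Definition J0_label (x : option (nat * bool) * rat) : option (nat * bool) * rat :=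
  match x with
  | (None, q) => (None, q)
  | (Some (i, b), q) => (Some (i, ~~ b), q)
  end.

Lemma J0_subproof (v : vertex) : is_vertex (J0_label (vlabel v)).
Proof. by case: v => -[[[i b]|] q]. Qed.

Definition J0 (v : vertex) : vertex := Vertex (J0_subproof v).

Lemma J0K : involutive J0.
Proof. by case=> -[[[i b]|] q] vP; apply: val_inj; rewrite //= negbK. Qed.

Lemma vgr_J0 v : vgr (J0 v) = vgr v.
Proof. by case: v => -[[[i b]|] q]. Qed.

Lemma J0_down v : J0 (down v) = down (J0 v).
Proof. by case: v => -[[[i b]|] q] vP; apply: val_inj => //=; case: eqP. Qed.

Lemma J0_iter_down k v : J0 (iter k down v) = iter k down (J0 v).
Proof. by elim: k => //= k IH; rewrite J0_down IH. Qed.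

Lemma vgr_down v : vgr (down v) = vgr v - 2.
Proof. by case: v => -[[[i b]|] q] vP //=; rewrite /vgr /=; case: eqP. Qed.

Lemma vgr_iter_down k v : vgr (iter k down v) = vgr v - k.*2%:R.
Proof.
elim: k => [|k IH]; first by rewrite subr0.
by rewrite /= vgr_down IH doubleS -addn2 natrD; lra.
Qed.

Lemma to_stem v : exists k, (vlabel (iter k down v)).1 = None.
Proof.
case: v => -[[[i b]|] q] vP; last by exists 0%N.
have /and4P[il rq qh eq_] := vP.
have ehr : even_diff (mr_h i) (mr_r i) by rewrite mr_even ?mr_h_in ?mr_r_in.
have erq : even_diff q (mr_r i) by rewrite even_diff_sym in eq_; apply: even_diff_trans eq_ ehr.
have [k qE] := even_diffP (ltW rq) erq.
elim: k q vP qE {rq qh eq_ erq} => [|k IH] q vP qE.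
  by have /and4P[_ lt _ _] := vP; move: lt; rewrite {1}qE addr0 ltxx.
case: (boolP (q - 2 == mr_r i)) => e.
  by exists 1%N; rewrite /= e.
have dP : is_vertex (Some (i, b), q - 2).
  by have := down_subproof (Vertex vP); rewrite /= (negbTE e).
have [] := IH _ dP.
  by rewrite qE doubleS -addn2 natrD; lra.
move=> m mE; exists m.+1; rewrite iterSr -mE; congr (vlabel (iter _ _ _)).1.
by apply: val_inj; rewrite /= (negbTE e).
Qed.

Lemma stem_eq v w : (vlabel v).1 = None -> (vlabel w).1 = None ->
  vgr v = vgr w -> v = w.
Proof.
case: v w => -[a q] vP [[b s] wP] /= ea eb; rewrite /vgr /= => qs.
by apply: val_inj; rewrite /= ea eb qs.
Qed.

Lemma stem_iter v k : (vlabel v).1 = None -> (vlabel (iter k down v)).1 = None.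
Proof.
move=> vN; elim: k => //= k; case: (iter k down v) => -[a q] /= _ ->.
by [].
Qed.

Lemma stem_even v : (vlabel v).1 = None -> even_diff (mr_r legs.-1) (vgr v).
Proof. by case: v => -[[x|] q] vP //= _; have /andP[] := vP. Qed.

Lemma vmeet_ex v w : exists k, `[< exists l, iter k down v = iter l down w >].
Proof.
wlog: v w / exists k l, [/\ (vlabel (iter k down v)).1 = None,
    (vlabel (iter l down w)).1 = None & vgr (iter l down w) <= vgr (iter k down v)].
  move=> H; have [k kN] := to_stem v; have [l lN] := to_stem w.
  case: (leP (vgr (iter l down w)) (vgr (iter k down v))) => le.
    by apply: H; exists k, l.
  have [] := H w v; first by exists l, k; rewrite lN kN ltW.
  by move=> a /asboolP[b e]; exists b; apply/asboolP; exists a.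
move=> [k [l [kN lN le]]].
have [] := even_diffP le.
  by apply: even_diff_trans (stem_even lN); rewrite even_diff_sym stem_even.
move=> m e; exists (m + k)%N; apply/asboolP; exists l.
rewrite iterD; apply: stem_eq => //; first exact: stem_iter.
by rewrite vgr_iter_down e addrK.
Qed.

(* The highest vertex at which the degree-decreasing paths from v and w meet. *)
Definition vmeet (v w : vertex) : vertex := iter (ex_minn (vmeet_ex v w)) down v.

Lemma vmeetP v w :
  [/\ exists k, vmeet v w = iter k down v, exists l, vmeet v w = iter l down w &
      forall k l, iter k down v = iter l down w ->
                  vgr (iter k down v) <= vgr (vmeet v w)].
Proof.
rewrite /vmeet; case: ex_minnP => m /asboolP[l e] mmin; split; first by exists m.
  by exists l.
move=> k j ekj; rewrite !vgr_iter_down lerD2l lerN2 ler_nat leq_double.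
by apply: mmin; apply/asboolP; exists j.
Qed.

Lemma vmeetC v w : vgr (vmeet v w) = vgr (vmeet w v).
Proof.
have [[k ek] [l el] mx] := vmeetP v w; have [[i ei] [j ej] mx'] := vmeetP w v.
apply: le_anti; apply/andP; split.
  by rewrite el (mx' l k) // -el.
by rewrite ej (mx j i) // -ej.
Qed.

Lemma vmeet_J0_le v w : vgr (vmeet v w) <= vgr (vmeet (J0 v) (J0 w)).
Proof.
have [[k ek] [l el] _] := vmeetP v w; have [_ _ mx] := vmeetP (J0 v) (J0 w).
have := mx k l; rewrite -!J0_iter_down vgr_J0 -ek; apply.
by rewrite -el.
Qed.

Lemma vmeet_J0 v w : vgr (vmeet (J0 v) (J0 w)) = vgr (vmeet v w).
Proof.
by apply: le_anti; rewrite vmeet_J0_le andbT -{2}[v]J0K -{2}[w]J0K vmeet_J0_le.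
Qed.

Definition leaf_label (i : nat) : option (nat * bool) * rat :=
  if mr_r i < mr_h i then (Some (i, false), mr_h i) else (None, mr_h i).

Lemma leaf_subproof (i : 'I_legs) : is_vertex (leaf_label i).
Proof.
rewrite /leaf_label; case: ltP => [lt|le] /=.
  by rewrite ltn_ord lt lexx even_diffxx.
have /eqP e : mr_r i == mr_h i by rewrite eq_le le mr_le.
by rewrite -e mr_r_le //= mr_even ?mr_r_in // legs_pred_lt.
Qed.

Definition leaf (i : 'I_legs) : vertex := Vertex (leaf_subproof i).

(* The leaves from left to right, v_n being listed once when J_0 v_n = v_n. *)
Definition left_leaves : seq vertex := [seq leaf i | i <- enum 'I_legs].
Definition leaves : seq vertex :=
  left_leaves ++ rev [seq J0 v | v <- left_leaves & J0 v != v].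

Lemma left_leavesE : exists l v,
  left_leaves = rcons l v /\ all (fun w => J0 w != w) l.
Proof.
have sz : size left_leaves = legs by rewrite size_map size_enum_ord.
case/lastP E : left_leaves => [|l v].
  by have := legs_gt0; rewrite -sz E.
exists l, v; split=> //; apply/(all_nthP v) => j jl.
have jlegs : (j < legs.-1)%N.
  by move: sz; rewrite E size_rcons => <-.
have jl2 : (j < legs)%N by lia.
have -> : nth v l j = leaf (Ordinal jl2).
  have -> : nth v l j = nth v left_leaves j by rewrite E nth_rcons jl.
  rewrite (nth_map (Ordinal jl2)) ?size_enum_ord //; congr leaf.
  by apply: val_inj; rewrite /= nth_enum_ord.
by apply/negP => /eqP /(congr1 vlabel) /=; rewrite /leaf_label mr_lt.
Qed.

Lemma leaves_sym : rev [seq J0 v | v <- leaves] = leaves.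
Proof.
rewrite /leaves; have [l [v [-> /all_filterP al]]] := left_leavesE.
rewrite -cats1 filter_cat al /= map_cat rev_cat map_rev revK.
rewrite -!map_comp /=; case: ifP => [_|/negbFE/eqP vI].
  rewrite !map_cat !rev_cat /= -!catA /= J0K; congr (_ ++ _).
  by rewrite (eq_map (g := id)) ?map_id // => x /=; rewrite J0K.
rewrite cats0 map_cat rev_cat /= vI -catA /=; congr (_ ++ _).
by rewrite (eq_map (g := id)) ?map_id // => x /=; rewrite J0K.
Qed.

Lemma leaves_size : (0 < size leaves)%N.
Proof.
by rewrite size_cat size_map size_enum_ord (leq_trans legs_gt0) ?leq_addr.
Qed.

End MonotoneRootTheory.

(* For a list of odd size, repeats the middle element. *)
Definition double_middle (T : Type) (s : seq T) : seq T :=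
  take (size s)./2.+1 s ++ drop (size s)./2 s.

Section LocalEquivalence.

(* U^{-1}H_*(C) is isomorphic to F[U,U^{-1}], by an isomorphism shifting degrees
   by s, with s (hence every degree of U^{-1}H_*(C)) in tau + 2Z.  F[U,U^{-1}]
   is the localization of FU itself. *)
Definition is_tower (C : complex) (tau : rat) : Prop :=
  exists f : {linear Uloc (FU^o) -> Uloc (homology C)},
    bijective f /\
    exists s, even_diff s tau /\
      forall q x, Uloc_homog homogFU q x ->
                  Uloc_homog (@homology_homog C) (q + s) (f x).

Definition is_iota_support (C : complex) (tau : rat) : Prop :=
  forall q (x : freemod (gens C)), cx_homog q x -> x != 0 -> q - tau \is a Num.int.

Record iota_complex := IotaComplex {
  ic_complex :> complex;
  ic_tower : exists tau, is_iota_support ic_complex tau /\ is_tower ic_complex tau;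
  ic_iota : chain_map ic_complex ic_complex;
  ic_iota2 : homotopic (C := ic_complex) (D := ic_complex) (ic_iota \o ic_iota) id
}.

Definition local_map (X Y : iota_complex) : Prop :=
  exists F : chain_map X Y,
    homotopic (F \o ic_iota X) (ic_iota Y \o F) /\
    bijective (Uloc_map (homology_map F)).

Definition locally_equivalent (X Y : iota_complex) : Prop :=
  local_map X Y /\ local_map Y X.

End LocalEquivalence.

Section FreeModules.

Definition gen (I : finType) (i : I) : freemod I := [ffun j => (j == i)%:R].

(* The linear map sending the generator i to b i. *)
Definition linext (I J : finType) (b : I -> freemod J) (x : freemod I) : freemod J :=
  \sum_i (x i : FU) *: b i.

Lemma linext_linear (I J : finType) (b : I -> freemod J) : linear (linext b).
Proof.
move=> a x y; rewrite /linext scaler_sumr -big_split; apply: eq_bigr => i _ /=.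
by rewrite !ffunE scalerDl scalerA.
Qed.
HB.instance Definition _ (I J : finType) (b : I -> freemod J) :=
  GRing.isLinear.Build FU (freemod I) (freemod J) _ (linext b) (linext_linear b).

Lemma linext_gen (I J : finType) (b : I -> freemod J) i : linext b (gen i) = b i.
Proof.
rewrite /linext (bigD1 i) //= ffunE eqxx scale1r big1 ?addr0 // => j ji.
by rewrite ffunE (negbTE ji) scale0r.
Qed.

Lemma gen_sum (I : finType) (x : freemod I) : x = \sum_i (x i : FU) *: gen i.
Proof.
apply/ffunP => j; rewrite sum_ffunE (bigD1 j) //= big1 => [|i ij].
  by rewrite addr0 !ffunE eqxx [_ *: _]mulr1.
by rewrite !ffunE eq_sym (negbTE ij) [_ *: _]mulr0.
Qed.

Lemma linear_gen_eq (I J : finType) (f g : {linear freemod I -> freemod J}) :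
  (forall i, f (gen i) = g (gen i)) -> forall x, f x = g x.
Proof.
move=> fg x; rewrite [x]gen_sum !linear_sum; apply: eq_bigr => i _.
by rewrite !linearZ /= fg.
Qed.

Lemma homog0 (I : finType) (gr : I -> rat) q : homog gr q 0.
Proof. by move=> i k; rewrite ffunE coef0 eqxx. Qed.

Lemma homogD (I : finType) (gr : I -> rat) q x y :
  homog gr q x -> homog gr q y -> homog gr q (x + y).
Proof.
move=> hx hy i k; rewrite ffunE coefD => n0.
case: (eqVneq (x i : FU)`_k 0) => [x0|]; last exact: hx.
by apply: hy; apply: contra_neq n0 => ->; rewrite x0 addr0.
Qed.

Lemma homog_sum (I : finType) (gr : I -> rat) q (J : finType) (F : J -> freemod I) :
  (forall j, homog gr q (F j)) -> homog gr q (\sum_j F j).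
Proof. by move=> hF; elim/big_ind: _ => //; [exact: homog0 | exact: homogD]. Qed.

Lemma homog_Ugen (I : finType) (gr : I -> rat) q i a :
  gr i - a.*2%:R = q -> homog gr q (U ^+ a *: gen i).
Proof.
move=> e j k; rewrite !ffunE; case: (j =P i) => [->|_]; last by rewrite [_ *: _]mulr0 coef0 eqxx.
by rewrite [_ *: _]mulr1 coefXn; case: (k =P a) => [->|_]; rewrite ?eqxx.
Qed.

Lemma homog_gen (I : finType) (gr : I -> rat) i : homog gr (gr i) (gen i).
Proof. by rewrite -[gen i]scale1r -(expr0 U); apply: homog_Ugen; rewrite subr0. Qed.

Lemma linext_degree (I J : finType) (gI : I -> rat) (gJ : J -> rat) (d : rat)
    (b : I -> freemod J) :
  (forall i, homog gJ (gI i + d) (b i)) -> map_degree gI gJ d (linext b).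
Proof.
move=> hb q x hx; apply: homog_sum => i j k; rewrite ffunE coefM => n0.
have [a an0] : exists a : 'I_k.+1, (x i : FU)`_a * (b i j : FU)`_(k - a) != 0.
  apply/existsP; apply: contraNT n0 => /existsPn H; rewrite big1 // => a _.
  by have := H a; rewrite negbK => /eqP.
move: an0; rewrite mulf_eq0 negb_or => /andP[/hx e1 /hb e2].
have e3 : k.*2%:R = a.*2%:R + (k - a).*2%:R :> rat.
  by rewrite -natrD -doubleD subnKC // -ltnS.
by rewrite -e1 e3 opprD addrA addrAC e2 addrAC.
Qed.

End FreeModules.

Section StandardComplex.
Variables (M : monotone_root) (n : nat) (s : 'I_n.+1 -> vertex M).

Definition half_diff (p q : rat) : nat := Num.truncn ((p - q) / 2).

Lemma half_diffE p q k : q = p - k.*2%:R -> half_diff p q = k.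
Proof.
move=> ->; rewrite /half_diff -mul2n natrM.
have -> : (p - (p - 2 * k%:R)) / 2 = k%:R :> rat by lra.
exact: natrK.
Qed.

Lemma half_diff_meetl (v w : vertex M) :
  vgr v - (half_diff (vgr v) (vgr (vmeet v w))).*2%:R = vgr (vmeet v w).
Proof.
by have [[k e] _ _] := vmeetP v w; rewrite e vgr_iter_down (half_diffE (k := k)).
Qed.

Lemma half_diff_meetr (v w : vertex M) :
  vgr w - (half_diff (vgr w) (vgr (vmeet v w))).*2%:R = vgr (vmeet v w).
Proof. by rewrite vmeetC half_diff_meetl. Qed.

Notation alpha_l i := (widen_ord (leqnSn n) i).
Notation alpha_r i := (lift ord0 i).

(* gr(alpha_i); the generator alpha_i has degree gr(alpha_i) + 1. *)
Definition alpha_gr (i : 'I_n) : rat := vgr (vmeet (s (alpha_l i)) (s (alpha_r i))).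

Definition std_gens : finType := ('I_n.+1 + 'I_n)%type.

Definition std_deg (g : std_gens) : rat :=
  match g with
  | inl i => vgr (s i)
  | inr i => alpha_gr i + 1
  end.

Definition std_bd_gen (g : std_gens) : freemod std_gens :=
  match g with
  | inl i => 0
  | inr i =>
      U ^+ half_diff (vgr (s (alpha_l i))) (alpha_gr i) *: gen (inl (alpha_l i))
    + U ^+ half_diff (vgr (s (alpha_r i))) (alpha_gr i) *: gen (inl (alpha_r i))
  end.

Definition std_bd : {linear freemod std_gens -> freemod std_gens} := linext std_bd_gen.

Lemma std_bd_degree : map_degree std_deg std_deg (-1) std_bd.
Proof.
apply: linext_degree => -[i|i] /=; first exact: homog0.
rewrite addrK; apply: homogD; apply: homog_Ugen.
  exact: half_diff_meetl.
exact: half_diff_meetr.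
Qed.

Lemma std_bd_genl i : std_bd (gen (inl i)) = 0.
Proof. exact: linext_gen. Qed.

Lemma std_bd_genr i : std_bd (gen (inr i)) = std_bd_gen (inr i).
Proof. exact: linext_gen. Qed.

Lemma std_bd_bd x : std_bd (std_bd x) = 0.
Proof.
have /= := @linear_gen_eq _ _ (std_bd \o std_bd)%FUN \0; apply=> -[i|i] /=.
  by rewrite std_bd_genl linear0.
by rewrite std_bd_genr linearD !linearZ /= !std_bd_genl !scaler0 addr0.
Qed.

Definition std_complex : complex := Complex std_bd_degree std_bd_bd.

Definition std_J0_gen (g : std_gens) : std_gens :=
  match g with
  | inl i => inl (rev_ord i)
  | inr i => inr (rev_ord i)
  end.

Definition std_J0 : {linear freemod std_gens -> freemod std_gens} :=
  linext (fun g => gen (std_J0_gen g)).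

Hypothesis s_sym : forall i, s (rev_ord i) = J0 (s i).

Lemma alpha_l_rev (i : 'I_n) : alpha_l (rev_ord i) = rev_ord (alpha_r i).
Proof. by apply: val_inj; rewrite /= /bump /=; lia. Qed.

Lemma alpha_r_rev (i : 'I_n) : alpha_r (rev_ord i) = rev_ord (alpha_l i).
Proof.
have ltin := ltn_ord i; apply: val_inj; rewrite /= /bump leq0n add1n.
by rewrite subSS subnSK.
Qed.

Lemma alpha_gr_rev (i : 'I_n) : alpha_gr (rev_ord i) = alpha_gr i.
Proof. by rewrite /alpha_gr alpha_l_rev alpha_r_rev !s_sym vmeet_J0 vmeetC. Qed.

Lemma std_deg_J0 g : std_deg (std_J0_gen g) = std_deg g.
Proof. by case: g => i /=; rewrite ?alpha_gr_rev // s_sym vgr_J0. Qed.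

Lemma std_J0_degree : map_degree (@gdeg std_complex) (@gdeg std_complex) 0 std_J0.
Proof.
by apply: (linext_degree (gI := std_deg) (gJ := std_deg)) => g; rewrite addr0 -std_deg_J0; apply: homog_gen. Qed.

Lemma std_J0_genE g : std_J0 (gen g) = gen (std_J0_gen g).
Proof. exact: linext_gen. Qed.

Lemma std_J0_bd x : std_J0 (bd std_complex x) = bd std_complex (std_J0 x).
Proof.
have /= := @linear_gen_eq _ _ (std_J0 \o std_bd)%FUN (std_bd \o std_J0)%FUN.
apply=> -[i|i] /=; rewrite std_J0_genE.
  by rewrite !std_bd_genl linear0.
rewrite !std_bd_genr linearD !linearZ /= !std_J0_genE /=.
by rewrite alpha_gr_rev alpha_l_rev alpha_r_rev !s_sym !vgr_J0 addrC.
Qed.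

Definition std_J0_map : chain_map std_complex std_complex :=
  ChainMap std_J0_degree std_J0_bd.

Lemma std_J0K x : std_J0 (std_J0 x) = x.
Proof.
have /= := @linear_gen_eq _ _ (std_J0 \o std_J0)%FUN idfun.
apply=> g /=; rewrite !std_J0_genE; congr gen.
by case: g => i /=; rewrite rev_ordK.
Qed.

Lemma std_J0_homotopic :
  homotopic (C := std_complex) (D := std_complex) (std_J0_map \o std_J0_map) id.
Proof.
exists \0; split=> [q x _|x]; first exact: homog0.
by rewrite /= std_J0K subrr linear0 addr0.
Qed.

End StandardComplex.

Section VertexDegrees.
Variable M : monotone_root.

Lemma vgr_top (v : vertex M) : exists t, vgr v = mr_h M 0 - t.*2%:R.
Proof.
have l0 := legs_gt0 M.
have hh i : (i < legs M)%N -> mr_h M i <= mr_h M 0.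
  by case: i => [//|i] il; apply: ltW; apply: mr_h_gt.
have [le ev] : vgr v <= mr_h M 0 /\ even_diff (mr_h M 0) (vgr v).
  case: v => -[[[i b]|] q] /= vP; rewrite /vgr /=.
    have /and4P[il _ qh hq] := vP; split; first exact: le_trans qh (hh _ il).
    by apply: even_diff_trans hq; rewrite (mr_even (M := M)) ?mr_h_in.
  have /andP[qr rq] := vP; have lp := legs_pred_lt M; split.
    exact: le_trans qr (le_trans (mr_last M) (hh _ lp)).
  by apply: even_diff_trans rq; rewrite (mr_even (M := M)) ?mr_h_in ?mr_r_in.
by have [t ->] := even_diffP le ev; exists t; rewrite addrK.
Qed.

Lemma vgr_even (v w : vertex M) : even_diff (vgr v) (vgr w).
Proof.
have [t ->] := vgr_top v; have [u ->] := vgr_top w.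
apply: (@even_diff_trans (mr_h M 0)); last rewrite even_diff_sym.
  by have := even_diffE (mr_h M 0 - t.*2%:R) t; rewrite subrK even_diff_sym.
by have := even_diffE (mr_h M 0 - u.*2%:R) u; rewrite subrK even_diff_sym.
Qed.

Lemma even_diff_int p q : even_diff p q -> p - q \is a Num.int.
Proof.
rewrite /even_diff => pq; have -> : p - q = (p - q) / 2 + (p - q) / 2 by lra.
exact: rpredD.
Qed.

End VertexDegrees.

Section StandardTower.
Variables (M : monotone_root) (n : nat) (s : 'I_n.+1 -> vertex M).
Let C := std_complex s.
Let G := std_gens n.

Lemma addrr_char2 (x : FU) : x + x = 0.
Proof.
rewrite -mulr2n -scaler_nat; have -> : 2%:R = 0 :> 'F_2 by apply: val_inj.
exact: scale0r.
Qed.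

(* The augmentation v_i |-> U^(t_i), alpha_i |-> 0, with deg v_i + 2 t_i
   independent of i. *)
Definition topd (v : vertex M) : nat := half_diff (mr_h M 0) (vgr v).

Lemma topdE v : vgr v = mr_h M 0 - (topd v).*2%:R.
Proof. by have [t e] := vgr_top v; rewrite /topd (half_diffE e). Qed.

Lemma topd_down (v : vertex M) k : topd (iter k (@down M) v) = (topd v + k)%N.
Proof.
rewrite {1}/topd; apply: half_diffE.
by rewrite vgr_iter_down topdE doubleD natrD; lra.
Qed.

Lemma topd_meetl v w :
  (topd v + half_diff (vgr v) (vgr (vmeet v w)) = topd (vmeet v w))%N.
Proof.
have [[k e] _ _] := vmeetP v w; rewrite e topd_down; congr addn.
by apply: half_diffE; rewrite vgr_iter_down.
Qed.

Lemma topd_meetr v w :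
  (topd w + half_diff (vgr w) (vgr (vmeet v w)) = topd (vmeet v w))%N.
Proof.
have [_ [k e] _] := vmeetP v w; rewrite e topd_down; congr addn.
by apply: half_diffE; rewrite vgr_iter_down.
Qed.

Definition aug_gen (g : G) : freemod unit :=
  match g with
  | inl i => U ^+ topd (s i) *: gen tt
  | inr _ => 0
  end.

Definition aug : {linear freemod G -> freemod unit} := linext aug_gen.

Lemma UscaleA (N : lmodType FU) a b (x : N) : U ^+ a *: (U ^+ b *: x) = U ^+ (b + a) *: x.
Proof. by rewrite scalerA -exprD addnC. Qed.

Lemma aug_genl i : aug (gen (inl i)) = U ^+ topd (s i) *: gen tt.
Proof. exact: linext_gen. Qed.

Lemma aug_bd x : aug (std_bd s x) = 0.
Proof.
have /= := @linear_gen_eq _ _ (aug \o std_bd s)%FUN \0; apply=> -[i|i] /=.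
  by rewrite std_bd_genl linear0.
rewrite std_bd_genr linearD !linearZ /= !aug_genl !UscaleA.
rewrite /alpha_gr topd_meetl topd_meetr.
by rewrite -scalerDl addrr_char2 scale0r.
Qed.

Lemma gen_cycle i : gen (inl i) \in is_cycle C.
Proof. by rewrite inE; apply/eqP; apply: std_bd_genl. Qed.

Definition cyc i : cycle C := Cycle (gen_cycle i).
Definition cls i : homology C := \pi_(homology C) (cyc i).

Definition mulcls0 (p : FU^o) : homology C := (p : FU) *: cls ord0.

Lemma mulcls0_linear : linear mulcls0.
Proof. by move=> a p q; rewrite /mulcls0 scalerDl scalerA. Qed.
HB.instance Definition _ := GRing.isLinear.Build FU (FU^o) (homology C) _
  mulcls0 mulcls0_linear.

Lemma pi_homologyZ a z :
  a *: \pi_(homology C) z = \pi_(homology C) (a *: z) :> homology C.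
Proof. exact: pi_homology_scale. Qed.

Lemma pi_homology_eq0 (z : cycle C) :
  \pi_(homology C) z = 0 :> homology C <-> exists y, val z = bd C y.
Proof.
have -> : 0 = \pi_(homology C) 0 :> homology C.
  by rewrite -[0 in RHS](scale0r 0) -pi_homologyZ scale0r.
split=> [/eqP|[y zy]].
  by rewrite homology_eqE subr0 => /asboolP.
by apply/eqP; rewrite homology_eqE subr0; apply/asboolP; exists y.
Qed.

Lemma mulcls0_eq0 p : mulcls0 p = 0 -> p = 0.
Proof.
rewrite /mulcls0 pi_homologyZ => /pi_homology_eq0[y /= /(congr1 aug)].
rewrite aug_bd linearZ /= [aug _]linext_gen /= scalerA => /ffunP /(_ tt).
rewrite !ffunE [_ *: _]mulr1 => /eqP; rewrite mulf_eq0 => /orP[/eqP //|].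
by rewrite expf_eq0 polyX_eq0 andbF.
Qed.

Definition tower_map : {linear Uloc (FU^o) -> Uloc (homology C)} := Uloc_map mulcls0.

Lemma Ufrac0 (N : lmodType FU) k : Ufrac (0 : N) k = 0.
Proof. by apply/UfracP; exists 0%N; rewrite !scaler0. Qed.

Lemma tower_map_inj : injective tower_map.
Proof.
apply: raddf_inj; elim/Ufrac_ind => p k; rewrite /= Uloc_mapE.
have -> : 0 = Ufrac (0 : homology C) 0 by rewrite Ufrac0.
move=> /UfracP[m]; rewrite scaler0 -linearZ /= => /mulcls0_eq0 /eqP.
rewrite [_ *: _]/(_ * _) mulf_eq0 expf_eq0 polyX_eq0 andbF /= => /eqP ->.
exact: Ufrac0.
Qed.

Lemma cls_step (i : 'I_n) :
  exists a b, U ^+ a *: cls (widen_ord (leqnSn n) i) = U ^+ b *: cls (lift ord0 i).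
Proof.
exists (half_diff (vgr (s (widen_ord (leqnSn n) i))) (alpha_gr s i)).
exists (half_diff (vgr (s (lift ord0 i))) (alpha_gr s i)).
apply/eqP; rewrite !pi_homologyZ homology_eqE; apply/asboolP.
exists (gen (inr i)); rewrite [RHS]std_bd_genr /=.
congr (_ + _); apply/eqP; rewrite eq_sym -subr_eq0 opprK; apply/eqP/ffunP => j.
rewrite [LHS]ffunE [RHS]ffunE; exact: addrr_char2.
Qed.

Definition in_tower (c : Uloc (homology C)) := exists x, tower_map x = c.

Lemma in_towerD c d : in_tower c -> in_tower d -> in_tower (c + d).
Proof. by move=> [x <-] [y <-]; exists (x + y); rewrite linearD. Qed.

Lemma in_towerZ a c : in_tower c -> in_tower (a *: c).
Proof. by move=> [x <-]; exists (a *: x); rewrite linearZ. Qed.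

Lemma in_tower_div (c : homology C) k j :
  in_tower (Ufrac c k) -> in_tower (Ufrac c (k + j)).
Proof.
move=> [x]; elim/Ufrac_ind: x => p l; rewrite /= Uloc_mapE => /UfracP[m e].
exists (Ufrac p (l + j)); rewrite /= Uloc_mapE; apply/UfracP; exists m.
by rewrite !addnA !(exprD _ _ j) ![_ * U ^+ j]mulrC -!scalerA e.
Qed.

Lemma in_tower_cls i : in_tower (Ufrac (cls i) 0).
Proof.
case: i; elim=> [|i IH] ltin.
  exists (Ufrac (1 : FU^o) 0); rewrite /= Uloc_mapE; congr Ufrac.
  by rewrite /= /mulcls0 scale1r; congr cls; apply: val_inj.
have lti : (i < n)%N by [].
have [a [b e]] := cls_step (Ordinal lti).
have {IH} := IH (ltn_trans lti (ltnSn n)).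
have -> : Ordinal (ltn_trans lti (ltnSn n)) = widen_ord (leqnSn n) (Ordinal lti).
  exact: val_inj.
have -> : Ordinal ltin = lift ord0 (Ordinal lti) by apply: val_inj.
move=> /(in_towerZ (U ^+ a)); rewrite UfracZ e => /(in_tower_div b) H.
by rewrite -(Ufrac_shift b) addnC.
Qed.

Lemma cycle_alpha0 (z : cycle C) i : val z (inr i) = 0.
Proof.
case: i => i; have [m] := ubnP i; elim: m i => // m IH i ltim ltin.
have : bd C (val z) = 0 by apply/eqP; exact: valP z.
move=> /ffunP.
move=> /(_ (inl (widen_ord (leqnSn n) (Ordinal ltin)))).
set v := inl _ => bdv.
have {bdv} : \sum_g (val z g : FU) * (std_bd_gen s g v : FU) = 0.
  move: bdv; rewrite /= /linext sum_ffunE [X in _ = X]ffunE => bdv.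
  by rewrite -[RHS]bdv; apply: eq_bigr => g _; rewrite ffunE.
rewrite (bigD1 (inr (Ordinal ltin))) //= big1 => [|[j|j]] /=.
- rewrite addr0 !ffunE eqxx /= => /eqP; rewrite mulf_eq0 => /orP[/eqP //|].
  rewrite (_ : v == _ = false) /=.
    by rewrite [_ *: _]mulr1 [_ *: _]mulr0 addr0 expf_eq0 polyX_eq0 andbF.
  by apply/negP => /eqP[] /=; rewrite /bump leq0n; lia.
- by rewrite ffunE mulr0.
move=> ji; case: (ltnP j i) => [lt|ge].
  have := IH j (leq_trans lt (ltnSE ltim)) (ltn_ord j).
  rewrite (_ : Ordinal _ = j); last exact: val_inj.
  by move=> ->; rewrite mul0r.
have ne : nat_of_ord j <> i.
  by move=> e; case/negP: ji; apply/eqP; congr inr; apply: val_inj.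
have nl : (v == inl (widen_ord (leqnSn n) j)) = false.
  by apply/negP => /eqP[] /=; lia.
have nr : (v == inl (lift ord0 j)) = false.
  by apply/negP => /eqP[] /=; rewrite /bump leq0n; lia.
by rewrite !ffunE nl nr /= ![_ *: _]mulr0 addr0 mulr0.
Qed.

Lemma cycle_cls (z : cycle C) :
  \pi_(homology C) z = \sum_i (val z (inl i) : FU) *: cls i :> homology C.
Proof.
pose pz := fun z => \pi_(homology C) z : homology C.
have lin : linear pz by exact: pi_homology_linear.
have pD x y : pz (x + y) = pz x + pz y by rewrite -[x in LHS]scale1r lin scale1r.
have p0 : pz 0 = 0 by apply: (@addrI _ (pz 0)); rewrite -pD !addr0.
have psum (F : 'I_n.+1 -> cycle C) : pz (\sum_i F i) = \sum_i pz (F i).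
  exact: (big_morph pz pD p0).
have zE : z = \sum_i (val z (inl i) : FU) *: cyc i.
  apply: val_inj; rewrite raddf_sum /= [LHS]gen_sum big_sumType /= [X in _ + X]big1.
    by rewrite addr0.
  by move=> i _; rewrite [cycle_val z _]cycle_alpha0 scale0r.
rewrite -/(pz z) [in LHS]zE psum; apply: eq_bigr => i _.
by rewrite /cls pi_homologyZ.
Qed.

Lemma tower_map_surj y : in_tower y.
Proof.
elim/Ufrac_ind: y => c k; rewrite -[k]add0n; apply: in_tower_div.
elim/quotW: c => z; rewrite [\pi_(_) z]cycle_cls.
have frD x y : Ufrac (x + y) 0 = Ufrac x 0 + Ufrac y 0 :> Uloc (homology C).
  by rewrite UfracD !scale1r.
rewrite (big_morph (fun x : homology C => Ufrac x 0) frD (Ufrac0 _ _)).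
elim/big_ind: _ => [|a b|i _]; last by rewrite -UfracZ; apply/in_towerZ/in_tower_cls.
  by exists 0; rewrite linear0.
exact: in_towerD.
Qed.

Lemma inj_surj_bijective (T : choiceType) (T' : eqType) (f : T -> T') :
  injective f -> (forall y, exists x, f x = y) -> bijective f.
Proof.
move=> finj fsurj; have ex y : exists x, f x == y by have [x <-] := fsurj y; exists x.
have gK y : f (xchoose (ex y)) = y by exact/eqP/(xchooseP (ex y)).
by exists (fun y => xchoose (ex y)) => // x; apply: finj.
Qed.

Lemma std_tower :
  exists tau, is_iota_support C tau /\ is_tower C tau.
Proof.
exists (vgr (s ord0)); split.
  move=> q x hx x0.
  have [g gx] : exists g, (x g : FU) != 0.
    apply/existsP; apply: contraNT x0 => /existsPn H; apply/eqP/ffunP => g.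
    by rewrite ffunE; apply/eqP; have := H g; rewrite negbK.
  have := hx g (size (x g : FU)).-1; rewrite -lead_coefE lead_coef_eq0 => /(_ gx) <-.
  rewrite addrAC; apply: rpredB; last exact: rpred_nat.
  case: g gx => i _ /=; first exact/even_diff_int/vgr_even.
  by rewrite addrAC; apply: rpredD => //; exact/even_diff_int/vgr_even.
exists tower_map; split.
  exact: inj_surj_bijective tower_map_inj tower_map_surj.
exists (vgr (s ord0)); split; first exact: even_diffxx.
move=> q _ [p [k [hp ->]]]; rewrite /= Uloc_mapE; exists (mulcls0 p), k; split=> //.
exists ((p : FU) *: cyc ord0); split; last by rewrite /= /mulcls0 pi_homologyZ.
move=> g j; rewrite /= !ffunE; case: (g =P inl ord0) => [->|_]; last first.
  by rewrite [_ *: _]mulr0 coef0 eqxx.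
by rewrite [_ *: _]mulr1 => /hp /=; lra.
Qed.

End StandardTower.

Section IotaComplexOfRoot.
Variable M : monotone_root.

(* The list on which the standard complex is built.  Repeating an invariant
   middle leaf v is the convention for an odd number of leaves: the two copies
   meet at v itself, so the odd generator between them has degree gr(v) + 1 and
   boundary the sum of the two copies, which J_0 exchanges. *)
Definition std_leaves : seq (vertex M) :=
  if odd (size (leaves M)) then double_middle (leaves M) else leaves M.

Lemma double_middle_sym (T : Type) (J : T -> T) (l : seq T) :
  odd (size l) -> rev [seq J v | v <- l] = l ->
  rev [seq J v | v <- double_middle l] = double_middle l.
Proof.
move=> ol e; rewrite /double_middle map_cat rev_cat map_take map_drop.
have sz : size [seq J v | v <- l] = size l by rewrite size_map.
rewrite rev_take rev_drop e sz.
have := odd_double_half (size l); rewrite ol => szE.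
by congr (take _ _ ++ drop _ _); lia.
Qed.

Lemma std_leaves_sym : rev [seq J0 v | v <- std_leaves] = std_leaves.
Proof.
rewrite /std_leaves; case: ifP => [o|_]; last exact: leaves_sym.
by apply: double_middle_sym => //; apply: leaves_sym.
Qed.

Lemma std_leaves_size : (0 < size std_leaves)%N.
Proof.
have := leaves_size M; rewrite /std_leaves; case: ifP => // _.
by case: (leaves M).
Qed.

Definition std_rank : nat := (size std_leaves).-1.

Definition std_leaf (i : 'I_std_rank.+1) : vertex M :=
  tnth (in_tuple std_leaves) (cast_ord (prednK std_leaves_size) i).

Lemma std_leaf_sym i : std_leaf (rev_ord i) = J0 (std_leaf i).
Proof.
pose v := std_leaf i; rewrite /std_leaf !(tnth_nth v) /=.
have il : (i < size std_leaves)%N.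
  by rewrite -[X in (_ < X)%N](prednK std_leaves_size) ltn_ord.
rewrite -{1}std_leaves_sym nth_rev size_map /=; last first.
  by move: il; rewrite /= /std_rank; lia.
by rewrite (nth_map v); [congr (J0 (nth _ _ _)) | ]; move: il; rewrite /std_rank; lia.
Qed.

Definition root_iota_complex : iota_complex :=
  IotaComplex (std_tower std_leaf) (std_J0_homotopic std_leaf_sym).

End IotaComplexOfRoot.

(* Main.v *)
From mathcomp Require Import all_boot all_order all_algebra.
From mathcomp Require Import boolp zify lra.
Require Import Defs.

Set Implicit Arguments.
Unset Strict Implicit.
Unset Printing Implicit Defensive.

Import Order.TTheory GRing.Theory Num.Theory.

Local Open Scope ring_scope.
Local Open Scope quotient_scope.

(** A monotone root is determined by its homology together with the action of
    [J0] on it, and a local map already forces an inequality between such data: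

    every leg [(h_i, r_i)] of [M] is dominated by some leg [(h'_j, r'_j)] of [M'],
    that is, [h_i <= h'_j] and [r_i <= r'_j].

    To see this, let [v] be the leaf of the [i]-th leg and [x = F v], of degree
    [h_i].  Since [F] is injective after inverting [U], [x] is not [U]-torsion,
    so its augmentation does not vanish ([local_aug_neq0]): up to terms in the
    [alpha]s, [x] is a sum of an odd number of terms [U^a v'_j], each of which can be
    read as the vertex of degree [h_i] below the leaf [v'_j].  Put
    [k = (h_i - r_i) / 2].  The paths below [v] and [J0 v] meet in degree [r_i],
    so [U^k v] and [U^k (J0 v)] are homologous ([level_boundary]); as [F] commutes
    with the involutions up to homotopy, [U^k x] and [J0 (U^k x)] are homologous too
    ([local_leaf]).  Homologous chains define the same formal
    sum of vertices mod 2 ([weight_bd]), so the vertices of degree [r_i] that occur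
    in [U^k x] form a [J0]-invariant multiset mod 2 of odd size.  Those off the stem
    are exchanged in pairs by [J0], hence the stem vertex occurs
    ([weight_on_stem]): some leaf [v'_j] of degree at least [h_i] has a path
    meeting the stem in degree at least [r_i].

    With local maps in both directions, each leg of [M] is dominated by a leg of
    [M'], itself dominated by a leg of [M].  Since the [h_i] decrease while the
    [r_i] increase, no leg of a monotone root is dominated by another one of the
    same root, so the two dominations are equalities and [M], [M'] have the same
    legs. *)

Lemma addrr_F2 (x : 'F_2) : x + x = 0.
Proof. exact: (addrr_pchar2 (pchar_Fp (isT : prime 2))). Qed.

Lemma freemod_addrr (I : finType) (x : freemod I) : x + x = 0.
Proof. by apply/ffunP => i; rewrite !ffunE; exact: Defs.addrr_char2. Qed.

(** * Descending the tree to a given level *)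

Section Levels.
Variable M : monotone_root.
Implicit Types (v w : vertex M) (e k : nat).

(** Levels are counted downwards from the top degree [mr_h M 0].  For a vertex
    lying strictly below level [e] the truncated subtraction makes this [v] itself,
    so statements about it carry the condition [topd v <= e]. *)
Definition at_level e v : vertex M := iter (e - topd v) (@down M) v.

Lemma topd_J0 v : topd (J0 v) = topd v.
Proof. by rewrite /topd vgr_J0. Qed.

Lemma J0_at_level e v : J0 (at_level e v) = at_level e (J0 v).
Proof. by rewrite /at_level J0_iter_down topd_J0. Qed.

Lemma at_level_iter_down e v k : (topd v + k <= e)%N ->
  at_level e (iter k (@down M) v) = at_level e v.
Proof.
move=> le; rewrite /at_level -iterD topd_down; congr iter; lia.
Qed.

Lemma at_level_meet e v w : (topd (vmeet v w) <= e)%N -> at_level e v = at_level e w.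
Proof.
have [[k ek] [l el] _] := vmeetP v w => le.
have := le; rewrite {1}ek topd_down => /at_level_iter_down <-.
have := le; rewrite {1}el topd_down => /at_level_iter_down <-.
by rewrite -ek -el.
Qed.

(** Paths that agree at level [e] have met by then, as the meeting vertex is the
    highest common one. *)
Lemma meet_at_level e v w : (topd v <= e)%N -> (topd w <= e)%N ->
  at_level e v = at_level e w -> (topd (vmeet v w) <= e)%N.
Proof.
move=> ve we eqvw; have [_ _ /(_ _ _ eqvw)] := vmeetP v w.
rewrite vgr_iter_down !topdE -addrA -opprD lerD2l lerN2 -natrD -doubleD ler_nat leq_double; lia.
Qed.

Lemma vlabel_iter_down v k a : (vlabel v).1 = Some a ->
  (vlabel (iter k (@down M) v)).1 = None \/ (vlabel (iter k (@down M) v)).1 = Some a.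
Proof.
move=> va; elim: k => [|k]; first by right.
rewrite iterS; case: (iter k _ v) => -[[[i b]|] q] wP /= [] // e; last by left.
by case: eqP => _; [left | right].
Qed.

(** The path from a vertex of the [i]-th leg enters the stem exactly in degree
    [mr_r M i]; [le_stem] is the other half. *)
Lemma stem_le v i b k : (vlabel v).1 = Some (i, b) ->
  (vlabel (iter k (@down M) v)).1 = None -> vgr (iter k (@down M) v) <= mr_r M i.
Proof.
move=> va; elim: k => [|k IH]; first by rewrite /= va.
have := vlabel_iter_down k va; rewrite iterS vgr_down => -[kN _|].
  by have := IH kN; lra.
by case: (iter k _ v) => -[a q] wP; rewrite /vgr /= => ->; case: eqP => // <-.
Qed.

Lemma le_stem v i b k : (vlabel v).1 = Some (i, b) ->
  vgr (iter k (@down M) v) <= mr_r M i -> (vlabel (iter k (@down M) v)).1 = None.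
Proof.
move=> va; have [//|] := vlabel_iter_down k va.
case: (iter k _ v) => -[a q] wP /= ea; move: wP; rewrite /vgr /= ea /=.
by move=> /and4P[_ lt _ _]; rewrite leNgt lt.
Qed.

Definition on_stem : pred (vertex M) := fun v => (vlabel v).1 == None.

Definition off_stem (b : bool) : pred (vertex M) :=
  fun v => if (vlabel v).1 is Some (_, c) then c == b else false.

Lemma off_stem_J0 b v : off_stem b (J0 v) = off_stem (~~ b) v.
Proof. by case: v => -[[[i c]|] q] vP //=; rewrite /off_stem /=; case: b c {vP} => -[]. Qed.

End Levels.

(** * Counting vertices of a chain mod 2 *)

Section Weight.
Variables (M : monotone_root) (n : nat) (s : 'I_n.+1 -> vertex M).
Implicit Types (P : pred (vertex M)) (e : nat) (x y : freemod (std_gens n)).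

(** Identifying [U^a v_j] with the vertex [a] steps below [v_j], a chain becomes a
    formal sum of vertices of the tree; this is the parity of the number of its
    vertices at level [e] that satisfy [P]. *)
Definition weight P e x : 'F_2 :=
  \sum_(j | (topd (s j) <= e)%N && P (at_level e (s j)))
    (x (inl j) : FU)`_(e - topd (s j)).

Lemma weight0 P e : weight P e 0 = 0.
Proof. by rewrite /weight big1 // => j _; rewrite ffunE coef0. Qed.

Lemma weightD P e : {morph weight P e : x y / x + y}.
Proof.
by move=> x y; rewrite /weight -big_split; apply: eq_bigr => j _; rewrite ffunE coefD.
Qed.

Lemma weight_Ugen P e p a j :
  weight P e (p *: (U ^+ a *: gen (inl j))) =
  if (topd (s j) + a <= e)%N && P (at_level e (s j))
  then p`_(e - (topd (s j) + a)) else 0.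
Proof.
have coefE i : ((p *: (U ^+ a *: gen (inl j) : freemod (std_gens n))) (inl i) : FU) =
    if i == j then p * U ^+ a else 0.
  rewrite !ffunE (inj_eq inl_inj); case: eqP => _; last by rewrite [X in _ *: X]mulr0 [LHS]mulr0.
  by rewrite [X in _ *: X]mulr1.
rewrite /weight big_mkcond (bigD1 j) //= big1 => [|i ij]; last first.
  by rewrite coefE (negbTE ij) coef0; case: ifP.
rewrite addr0 coefE eqxx coefMXn.
have [le_e|gt_e] := leqP (topd (s j)) e; last first.
  by rewrite (leqNgt (_ + a)%N) ltn_addr.
by rewrite /= -leq_subRL // [(a <= _)%N]leqNgt; case: ltnP; case: (P _) => //= le; rewrite ?subnDA.
Qed.

(** The two terms of the boundary of [alpha_i] have become the same vertex of the
    tree, so they cancel mod 2: the weights are invariants of homology classes. *)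
Lemma weight_bd P e y : weight P e (std_bd s y) = 0.
Proof.
rewrite /= /linext (big_morph (weight P e) (weightD P e) (weight0 P e)).
apply: big1 => -[i|i] _ /=; first by rewrite scaler0 weight0.
rewrite scalerDr weightD !weight_Ugen /alpha_gr topd_meetl topd_meetr.
case: leqP => //= [le_e|_]; last by rewrite addr0.
by rewrite (at_level_meet le_e) addrr_F2.
Qed.

Lemma weight_J0 P e x : (forall i, s (rev_ord i) = J0 (s i)) ->
  weight P e (std_J0 n x) = weight (P \o @J0 M) e x.
Proof.
move=> s_sym; have J0E i : std_J0 n x (inl i) = x (inl (rev_ord i)).
  rewrite /= /linext sum_ffunE (bigD1 (inl (rev_ord i))) //= big1 => [|g ne].
    by rewrite addr0 !ffunE rev_ordK eqxx [_ *: _]mulr1.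
  rewrite !ffunE; case: g ne => j ne /=; last by rewrite [_ *: _]mulr0.
  case: eqP => [[e1]|_]; last by rewrite [_ *: _]mulr0.
  by rewrite e1 rev_ordK eqxx in ne.
rewrite /weight (reindex_inj rev_ord_inj); apply: eq_big => [j|j _] /=.
  by rewrite s_sym topd_J0 J0_at_level.
by rewrite J0E rev_ordK s_sym topd_J0.
Qed.

Lemma weight_exists P e x : weight P e x != 0 ->
  exists j, [/\ (topd (s j) <= e)%N, P (at_level e (s j)) &
                (x (inl j) : FU)`_(e - topd (s j)) != 0].
Proof.
move=> w0; have [j /andP[/andP[le_e Pj] xj]] : exists j,
    ((topd (s j) <= e)%N && P (at_level e (s j))) &&
    ((x (inl j) : FU)`_(e - topd (s j)) != 0).
  apply/existsP; apply: contraNT w0 => /existsPn H; rewrite /weight big1 // => j Pj.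
  by apply/eqP; have := H j; rewrite Pj negbK.
by exists j.
Qed.

(** The augmentation is the count of all vertices of a chain, level by level. *)
Lemma coef_aug e x : (aug s x tt : FU)`_e = weight predT e x.
Proof.
rewrite /aug /= /linext sum_ffunE coef_sum big_sumType /= [X in _ + X]big1 => [|i _].
  rewrite addr0 /weight [RHS]big_mkcond; apply: eq_bigr => i _.
  rewrite !ffunE [_ *: 1]mulr1 [_ *: _]/(_ * _) coefMXn andbT.
  by case: ltnP.
by rewrite !ffunE [_ *: _]mulr0 coef0.
Qed.

Lemma weight_shift e k x :
  weight predT (e + k) (U ^+ k *: x) = weight predT e x.
Proof.
have augZ : aug s (U ^+ k *: x) tt = (aug s x tt : FU) * U ^+ k.
  by rewrite linearZ ffunE [LHS]mulrC.
by rewrite -!coef_aug augZ coefMXn ltnNge leq_addl addnK.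
Qed.

Lemma weight_sides e x :
  weight predT e x =
  weight (@on_stem M) e x + (weight (off_stem true) e x + weight (off_stem false) e x).
Proof.
rewrite /weight [LHS]big_mkcond [X in _ = X + _]big_mkcond.
rewrite [X in _ = _ + (X + _)]big_mkcond [X in _ = _ + (_ + X)]big_mkcond -!big_split /=.
apply: eq_bigr => j _; rewrite /on_stem /off_stem.
case: (_ <= _)%N => /=; last by rewrite !addr0.
by case: (vlabel _).1 => [[i []]|]; rewrite /= ?addr0 ?add0r.
Qed.

(** If [x] is homologous to its image under the involution, the two sides of the
    tree contribute equally to the parity of [x], so only the stem counts. *)
Lemma weight_on_stem e x y : (forall i, s (rev_ord i) = J0 (s i)) ->
  x + std_J0 n x = std_bd s y -> weight (@on_stem M) e x = weight predT e x.
Proof.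
move=> s_sym xJx; have := weight_bd (off_stem true) e y.
rewrite -xJx weightD weight_J0 // weight_sides => w0.
rewrite (_ : weight (off_stem false) e x = weight (off_stem true \o @J0 M) e x).
  by rewrite w0 addr0.
by apply: eq_bigl => j /=; rewrite off_stem_J0.
Qed.

(** If all the leaves from [i] to [j] have reached a common vertex at level [e], then
    the classes of the leaves [i] and [j] pushed down to level [e] coincide: the
    bounding chain is the telescoping sum of the [alpha]s in between. *)
Lemma level_boundary e (w : vertex M) (i j : 'I_n.+1) : (i <= j)%N ->
  (forall c : 'I_n.+1, (i <= c <= j)%N -> (topd (s c) <= e)%N /\ at_level e (s c) = w) ->
  exists y, U ^+ (e - topd (s i)) *: gen (inl i) + U ^+ (e - topd (s j)) *: gen (inl j)
            = std_bd s y.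
Proof.
case: j => j; elim: j => [|j IH] ltj.
  rewrite leqn0 => /eqP i0 _; exists 0.
  have -> : Ordinal ltj = i by apply: val_inj.
  by rewrite linear0 freemod_addrr.
rewrite leq_eqVlt => /predU1P[ij _|ij H].
  exists 0; have -> : Ordinal ltj = i by apply: val_inj.
  by rewrite linear0 freemod_addrr.
have ltj' : (j < n)%N by [].
pose a := Ordinal ltj'.
have [y yE] : exists y, U ^+ (e - topd (s i)) *: gen (inl i) +
    U ^+ (e - topd (s (widen_ord (leqnSn n) a))) *: gen (inl (widen_ord (leqnSn n) a))
            = std_bd s y.
  have -> : widen_ord (leqnSn n) a = Ordinal (ltnW ltj) by apply: val_inj.
  apply: IH => // c /andP[ic cj]; apply: H; rewrite ic /=; exact: leqW.
have [le1 e1] := H (widen_ord (leqnSn n) a) (introT andP (conj ij (leqnSn j))).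
have rE : lift ord0 a = Ordinal ltj by apply: val_inj.
have [le2 e2] := H (Ordinal ltj) (introT andP (conj (ltnW ij) (leqnn j.+1))).
have le3 := meet_at_level le1 le2 (etrans e1 (esym e2)).
set v := s (widen_ord _ _) in le1 e1 yE le3; set v' := s (Ordinal _) in le2 e2 le3 *.
exists (y + U ^+ (e - topd (vmeet v v')) *: gen (inr a)).
rewrite linearD /= -yE linearZ /= std_bd_genr /= scalerDr !UscaleA /alpha_gr rE -/v -/v'.
have l := topd_meetl v v'; have r := topd_meetr v v'.
have -> : (half_diff (vgr v) (vgr (vmeet v v')) + (e - topd (vmeet v v')) = e - topd v)%N.
  by lia.
have -> : (half_diff (vgr v') (vgr (vmeet v v')) + (e - topd (vmeet v v')) = e - topd v')%N.
  by lia.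
by rewrite -addrA [X in _ = _ + X]addrA freemod_addrr add0r.
Qed.

(** After inverting [U] the homology is the tower generated by any leaf, on which
    the augmentation is injective. *)
Lemma aug0_torsion (z : cycle (std_complex s)) : aug s (val z) = 0 ->
  exists m y, U ^+ m *: val z = std_bd s y.
Proof.
move=> az; have [c] := tower_map_surj (Ufrac (\pi_(homology (std_complex s)) z) 0).
elim/Ufrac_ind: c => p k; rewrite /= Uloc_mapE => /UfracP[m].
rewrite addn0 -linearZ /= => e; exists (m + k)%N.
have p0 : U ^+ m *: p = 0 :> FU^o.
  move: e; rewrite /mulcls0 !pi_homologyZ => /eqP; rewrite homology_eqE => /asboolP[y /=].
  move=> /(congr1 (aug s)); rewrite aug_bd linearB !linearZ /= az.
  rewrite oppr0 scaler0 addr0 linext_gen /= scalerA => /ffunP/(_ tt).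
  rewrite !ffunE [_ *: _]mulr1 => /eqP; rewrite mulf_eq0 => /orP[/eqP //|].
  by rewrite expf_eq0 polyX_eq0 andbF.
have /pi_homology_eq0 [y yE] :
    \pi_(homology (std_complex s)) (U ^+ (m + k) *: z) = 0 :> homology (std_complex s).
  by rewrite -pi_homologyZ -e p0 /mulcls0 scale0r.
by exists y; rewrite -yE.
Qed.

End Weight.

(** * Images of leaves under a local map *)

Section LocalMap.
Variables (M M' : monotone_root) (n n' : nat).
Variables (s : 'I_n.+1 -> vertex M) (s' : 'I_n'.+1 -> vertex M').
Variable F : chain_map (std_complex s) (std_complex s').
Hypothesis Finj : injective (Uloc_map (homology_map F)).

Lemma local_aug_neq0 i : aug s' (F (gen (inl i))) != 0.
Proof.
apply/eqP => a0; have [m [y yE]] := aug0_torsion (z := cycle_map F (cyc s i)) a0.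
have : Ufrac (cls s i) 0 = 0.
  apply: Finj; rewrite linear0 Uloc_mapE -(Ufrac0 _ 0); apply/UfracP; exists m.
  rewrite addn0 scaler0 [GRing.Linear.sort _ _]homology_mapE pi_homologyZ.
  by apply/pi_homology_eq0; exists y.
rewrite -(Ufrac0 _ 0) => /UfracP[k]; rewrite scaler0 /cls pi_homologyZ.
move=> /pi_homology_eq0[u /= /(congr1 (aug s))].
rewrite aug_bd linearZ /= aug_genl scalerA -exprD => /ffunP/(_ tt).
rewrite !ffunE [_ *: _]mulr1 => /eqP.
by rewrite expf_eq0 polyX_eq0 andbF.
Qed.

Hypothesis s_sym : forall i, s (rev_ord i) = J0 (s i).
Hypothesis s_sym' : forall i, s' (rev_ord i) = J0 (s' i).
Hypothesis Fiota :
  homotopic (C := std_complex s) (D := std_complex s') (F \o std_J0 n) (std_J0 n' \o F).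

(** The heart of the argument: once the leaves from [s i] to its mirror image have
    all merged in [w], [k] levels below [s i], the class of [U^k (s i)] is invariant,
    and so is its image, which then meets the stem: some leaf of [M'] at least as high
    as [s i] has a path that is on the stem in the degree of [w]. *)
Lemma local_leaf (i : 'I_n.+1) (k : nat) (w : vertex M) : (i <= rev_ord i)%N ->
  (forall c : 'I_n.+1, (i <= c <= rev_ord i)%N ->
     (topd (s c) <= topd (s i) + k)%N /\ at_level (topd (s i) + k) (s c) = w) ->
  exists j l, [/\ vgr (s i) <= vgr (s' j), (vlabel (iter l (@down M') (s' j))).1 = None &
                  vgr (iter l (@down M') (s' j)) = vgr w].
Proof.
move=> le_rev H; have [y yE] := level_boundary le_rev H.
have wE : vgr w = vgr (s i) - k.*2%:R.
  have [_ <-] := H i (introT andP (conj (leqnn i) le_rev)).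
  by rewrite /at_level addKn vgr_iter_down.
move: yE; rewrite s_sym topd_J0 addKn -scalerDr => yE.
pose x := F (gen (inl i)).
have [h [_ hE]] := Fiota.
(* The homotopy applied to a cycle leaves a single boundary term. *)
have JxE : F (gen (inl (rev_ord i))) + std_J0 n' x = std_bd s' (h (gen (inl i))).
  have /= := hE (gen (inl i)); rewrite std_J0_genE /= std_bd_genl linear0 addr0 => <-.
  congr (_ + _); apply: (@addrI _ (std_J0 n' x)); by rewrite freemod_addrr subrr.
have bdE : U ^+ k *: x + std_J0 n' (U ^+ k *: x)
    = std_bd s' (F y + U ^+ k *: h (gen (inl i))).
  rewrite linearD [std_bd s' (_ *: _)]linearZ /= -JxE.
  have /= <- := cmap_bd F y; rewrite -yE !linearZ /= linearD /= -!scalerDr; congr (_ *: _).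
  by rewrite -addrA [X in _ = _ + X]addrA freemod_addrr add0r.
(* [e] is the level of the degree of [x]: a nonzero coefficient of its augmentation. *)
have [e e0] : exists e, weight s' predT e x != 0.
  have /eqP := local_aug_neq0 i; rewrite -/x => a0.
  exists (size (aug s' x tt : FU)).-1; rewrite -coef_aug -lead_coefE lead_coef_eq0.
  by apply/eqP => a1; apply: a0; apply/ffunP => -[]; rewrite a1 ffunE.
have hx : homog (@std_deg M' n' s') (vgr (s i)) x.
  by have := @cmap_degree _ _ F _ _ (@homog_gen _ (@std_deg M n s) (inl i)); rewrite addr0.
have eE : vgr (s i) = mr_h M' 0 - e.*2%:R.
  have [j [le_e _ /hx <-]] := weight_exists e0.
  rewrite /= topdE -[e in RHS](subnKC le_e) doubleD natrD; lra.
have := e0; rewrite -(weight_shift _ _ k) -(weight_on_stem _ s_sym' bdE).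
move=> /weight_exists[j [le_e /eqP stem]].
have -> : (U ^+ k *: x) (inl j) = (x (inl j) : FU) * U ^+ k by rewrite ffunE [LHS]mulrC.
rewrite coefMXn; case: ltnP => [_|le_k _]; first by rewrite eqxx.
have le_j : (topd (s' j) <= e)%N by lia.
exists j, (e + k - topd (s' j))%N; split=> //.
  by rewrite eE topdE lerD2l lerN2 ler_nat leq_double.
rewrite vgr_iter_down wE eE topdE -addrA -[in RHS]addrA -!opprD -!natrD -!doubleD.
by rewrite subnKC.
Qed.

End LocalMap.

(** * Leaves and legs *)

(** Doubling an invariant middle leaf makes the two cases uniform: the copy that is
    added plays the part of the mirror image of the last leaf. *)
Lemma std_leavesE (M : monotone_root) :
  std_leaves M = left_leaves M ++ rev [seq J0 v | v <- left_leaves M].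
Proof.
rewrite /std_leaves /leaves; have [l [v [-> /all_filterP al]]] := left_leavesE M.
rewrite -cats1 filter_cat al /= !map_cat !rev_cat /=.
case: (altP (J0 v =P v)) => [vI|_] /=; last first.
  by rewrite !size_cat /= !(size_rev, size_map) addn1 addnn odd_double.
rewrite vI !(size_cat, size_rev, size_map) /= addn1 addSn addnn /= odd_double /=.
rewrite /double_middle !(size_cat, size_rev, size_map) addn1 addSn addnn.
have -> : ((size l).*2.+1)./2 = size l by lia.
by rewrite take_size_cat ?size_cat ?addn1 // -[in drop _ _]catA drop_size_cat.
Qed.

Lemma std_rankE (M : monotone_root) : (std_rank M).+1 = (legs M).*2.
Proof.
rewrite /std_rank prednK ?std_leaves_size // std_leavesE size_cat size_rev size_map.
by rewrite addnn /left_leaves size_map size_enum_ord.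
Qed.

Lemma std_leaf_left (M : monotone_root) (j : 'I_(std_rank M).+1) (jl : (j < legs M)%N) :
  std_leaf j = leaf (Ordinal jl).
Proof.
rewrite /std_leaf (tnth_nth (leaf (Ordinal jl))) /=.
case: j jl => j ltj /= jl; rewrite std_leavesE nth_cat.
rewrite /left_leaves size_map size_enum_ord jl (nth_map (Ordinal jl)) ?size_enum_ord //.
by congr leaf; apply: val_inj; rewrite /= nth_enum_ord.
Qed.

Lemma vgr_leaf (M : monotone_root) (i : 'I_(legs M)) : vgr (leaf i) = mr_h M i.
Proof. by rewrite /vgr /= /leaf_label; case: ifP. Qed.

Lemma leaf_on_stemP (M : monotone_root) (i : 'I_(legs M)) k :
  on_stem (iter k (@down M) (leaf i)) = (vgr (iter k (@down M) (leaf i)) <= mr_r M i).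
Proof.
have [lt|le] := ltP (mr_r M i) (mr_h M i).
  have e : (vlabel (leaf i)).1 = Some (val i, false) by rewrite /= /leaf_label lt.
  by apply/eqP/idP; [apply: stem_le e | apply: le_stem e].
rewrite /on_stem stem_iter; last by rewrite /= /leaf_label ltNge le.
rewrite eqxx vgr_iter_down vgr_leaf; symmetry; apply: le_trans le.
by rewrite lerBlDr lerDl ler0n.
Qed.

(** Every entry of the list lies on the leg whose index is its distance to the nearer
    end of the list. *)
Lemma std_leaf_on_stem (M : monotone_root) (j : 'I_(std_rank M).+1) :
  exists i : 'I_(legs M), (i = minn j (rev_ord j) :> nat) /\ vgr (std_leaf j) = mr_h M i /\
    forall k, on_stem (iter k (@down M) (std_leaf j)) =
              (vgr (iter k (@down M) (std_leaf j)) <= mr_r M i).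
Proof.
have jE := ltn_ord j; have rE := std_rankE M.
have [lt|le] := ltnP j (legs M).
  exists (Ordinal lt); rewrite (std_leaf_left lt) vgr_leaf; split; first by rewrite /=; lia.
  by split=> // k; apply: leaf_on_stemP.
have lt : (rev_ord j < legs M)%N by rewrite /=; lia.
have jE' : std_leaf j = J0 (leaf (Ordinal lt)).
  by rewrite -(std_leaf_left lt) -std_leaf_sym rev_ordK.
exists (Ordinal lt); rewrite jE' vgr_J0 vgr_leaf; split; first by rewrite /=; lia.
split=> // k; rewrite -J0_iter_down vgr_J0 -leaf_on_stemP.
by rewrite /on_stem /=; case: (iter k _ _) => -[[[a b]|] q].
Qed.

(** * Domination of legs *)

(** The leaves listed between [leaf i] and its mirror image belong to later legs,
    which join the stem no lower than [mr_r M i]; hence all of them have reached the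
    stem vertex of that degree, as [local_leaf] requires. *)
Lemma local_map_dominates (M M' : monotone_root) :
  local_map (root_iota_complex M) (root_iota_complex M') ->
  forall i, (i < legs M)%N -> exists2 j, (j < legs M')%N &
    mr_h M i <= mr_h M' j /\ mr_r M i <= mr_r M' j.
Proof.
move=> [F [Fiota /bij_inj Finj]] i il.
have rE := std_rankE M.
have il' : (i < (std_rank M).+1)%N by lia.
pose a := Ordinal il'.
have aE : std_leaf a = leaf (Ordinal il) := std_leaf_left (j := a) il.
have a_rev : (a <= rev_ord a)%N by rewrite /=; lia.
have [k hk] : exists k, mr_h M i = mr_r M i + k.*2%:R.
  by apply: even_diffP; rewrite ?mr_le // (mr_even (M := M)) ?mr_h_in ?mr_r_in.
have ea : mr_h M 0 - (topd (std_leaf a) + k).*2%:R = mr_r M i.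
  have := topdE (std_leaf a); rewrite {1}aE vgr_leaf /= hk doubleD natrD; lra.
pose w := at_level (topd (std_leaf a) + k) (std_leaf a).
have wE : vgr w = mr_r M i.
  by rewrite /w /at_level addKn vgr_iter_down topdE -ea doubleD natrD opprD addrA.
have w_stem : on_stem w.
  have wE' : w = iter k (@down M) (leaf (Ordinal il)) by rewrite /w /at_level addKn aE.
  by rewrite wE' leaf_on_stemP -wE' wE.
have H (c : 'I_(std_rank M).+1) : (a <= c <= rev_ord a)%N ->
    (topd (std_leaf c) <= topd (std_leaf a) + k)%N /\
    at_level (topd (std_leaf a) + k) (std_leaf c) = w.
  move=> /andP[ac ca]; have [j [jE [vc stem]]] := std_leaf_on_stem c.
  have ij : (i <= j)%N by move: ac ca; rewrite jE /=; have := ltn_ord c; lia.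
  have rij : mr_r M i <= mr_r M j.
    by move: ij; rewrite leq_eqVlt => /predU1P[-> //|ij]; apply/ltW/mr_r_lt; rewrite ij /=.
  have le : (topd (std_leaf c) <= topd (std_leaf a) + k)%N.
    rewrite -leq_double -(ler_nat rat) -lerN2 -(lerD2l (mr_h M 0)) ea -topdE vc.
    exact: le_trans rij (mr_le (ltn_ord j)).
  have gE : vgr (at_level (topd (std_leaf a) + k) (std_leaf c)) = mr_r M i.
    rewrite /at_level vgr_iter_down topdE -ea -addrA -opprD -natrD -doubleD subnKC //.
  split=> //; apply: stem_eq; last by rewrite gE wE.
    by apply/eqP; rewrite -/(on_stem _) stem -[iter _ _ _]/(at_level _ _) gE.
  exact/eqP.
have [j [l [hj lj vj]]] := local_leaf Finj (@std_leaf_sym M) (@std_leaf_sym M') Fiota a_rev H.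
have [j' [_ [vj' stem]]] := std_leaf_on_stem j.
exists j'; first exact: ltn_ord.
split; first by rewrite -vj'; move: hj; rewrite aE vgr_leaf.
by rewrite -wE -vj -stem; apply/eqP.
Qed.

(** A leg of [M] lies below a leg of [M'], which lies below a leg of [M]; by the
    monotonicity of [M] the latter is the leg one started from. *)
Lemma mutual_domination_subset (M M' : monotone_root) :
  (forall i, (i < legs M)%N -> exists2 j, (j < legs M')%N &
    mr_h M i <= mr_h M' j /\ mr_r M i <= mr_r M' j) ->
  (forall i, (i < legs M')%N -> exists2 j, (j < legs M)%N &
    mr_h M' i <= mr_h M j /\ mr_r M' i <= mr_r M j) ->
  {subset mr_params M <= mr_params M'}.
Proof.
move=> MM' M'M p /(nthP (0, 0))[i il <-].
have [j jl [hij rij]] := MM' i il; have [k kl [hjk rjk]] := M'M j jl.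
have ik : i = k.
  case: (ltngtP i k) => // [ik|ki].
    have := @mr_h_gt M i k; rewrite ik kl => /(_ isT); have := le_trans hij hjk.
    by rewrite leNgt => /negbTE ->.
  have := @mr_r_lt M k i; rewrite ki il => /(_ isT); have := le_trans rij rjk.
  by rewrite leNgt => /negbTE ->.
rewrite -ik in hjk rjk; apply/(nthP (0, 0)); exists j => //.
rewrite [RHS]surjective_pairing [LHS]surjective_pairing; congr (_, _).
  exact: le_anti (introT andP (conj hjk hij)).
exact: le_anti (introT andP (conj rjk rij)).
Qed.

Lemma mr_params_sorted (M : monotone_root) :
  sorted (fun p q : rat * rat => q.1 < p.1) M.
Proof. by case/and5P: (mr_monotone M) => _; rewrite sorted_map. Qed.

Theorem theorem6p2 (M M' : monotone_root) :
  locally_equivalent (root_iota_complex M) (root_iota_complex M') -> M = M'.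
Proof.
move=> [/local_map_dominates MM' /local_map_dominates M'M]; apply: val_inj.
apply: (irr_sorted_eq _ _ (mr_params_sorted M) (mr_params_sorted M')).
- by move=> q p r /= qp rq; apply: lt_trans rq qp.
- by move=> p; apply: ltxx.
- by move=> p; apply/idP/idP; apply: mutual_domination_subset.
Qed.
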